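(* Let $G$ be a finite group which is a semidirect product $G = K \rtimes H$, where $K$ is a normal subgroup of $G$, $H$ is a subgroup of $G$, $K \cap H = \{e\}$ and $G = HK$; thus every $g \in G$ can be written uniquely as $g = hk$ with $h \in H$, $k \in K$. Let $\rho_1^H, \ldots, \rho_r^H$ be a complete set of pairwise inequivalent irreducible unitary representations of $H$, of degrees $d_1^H, \ldots, d_r^H$ and characters $\chi_1^H, \ldots, \chi_r^H$, and let $\rho_1^K, \ldots, \rho_s^K$ be a complete set of pairwise inequivalent irreducible unitary representations of $K$, of degrees $d_1^K, \ldots, d_s^K$ and characters $\chi_1^K, \ldots, \chi_s^K$. Let $C_1, \ldots, C_r$ be the conjugacy classes of $H$ and choose $h_{C_i} \in C_i$ for each $i$. Let $\alpha : G \to \mathbb{C}$ be a function satisfying $$\alpha(h g k g^{-1}) = \alpha(hk) \quad \text{and} \quad \alpha(h' h h'^{-1} k) = \alpha(hk) \qquad \text{for all } g \in G,\ k \in K,\ h, h' \in H.$$ Let $A$ be the adjacency matrix of the Cayley color graph $\Gamma(G;\alpha)$, i.e. the matrix with rows and columns indexed by $G$ and entries $A_{g,g'} = \alpha(g' g^{-1})$. For $1 \le u \le r$, $1 \le v \le s$ put $$\lambda_{u,v} = \frac{1}{d_u^H d_v^K}\sum_{i=1}^r \Big( |C_i|\, \chi_u^H(h_{C_i}) \sum_{k \in K} \alpha(h_{C_i} k)\, \chi_v^K(k) \Big),$$ and for $1 \le i,j \le d_u^H$, $1 \le i',j' \le d_v^K$ let $w^{u,v}_{ij,i'j'} \in \mathbb{C}^G$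 be the vector (the tensor product $(\rho_u^H)_{ij} \otimes (\rho_v^K)_{i'j'}$) whose entry at $g = hk$ ($h \in H$, $k \in K$) is $$w^{u,v}_{ij,i'j'}(hk) = \sqrt{\frac{d_u^H d_v^K}{|H|\,|K|}}\; (\rho_u^H(h))_{ij}\, (\rho_v^K(k))_{i'j'}.$$ Then each $w^{u,v}_{ij,i'j'}$ is an eigenvector of $A$ with eigenvalue $\lambda_{u,v}$, and these vectors (over all $u, v, i, j, i', j'$) form a basis of $\mathbb{C}^G$. Consequently the spectrum of $\Gamma(G;\alpha)$ consists of the numbers $\lambda_{u,v}$, $1 \le u \le r$, $1 \le v \le s$ (each $\lambda_{u,v}$ counted $(d_u^H d_v^K)^2$ times), with the corresponding eigenspaces spanned by the vectors $w^{u,v}_{ij,i'j'}$.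
   Context: For a finite group $G$ and a function $\alpha: G \to \mathbb{C}$, the Cayley color graph $\Gamma(G;\alpha)$ has vertex set $G$ and assigns to the directed edge $(g,g')$ the color $\alpha(g'g^{-1})$; its adjacency matrix is $(\alpha(g'g^{-1}))_{g,g' \in G}$, and its spectrum is the spectrum of this matrix. A unitary representation $\rho$ of degree $d$ assigns to each group element a $d\times d$ unitary matrix; $(\rho(x))_{ij}$ denotes the $(i,j)$ entry. *)

(* Defs.v *)
From HB Require Import structures.
From mathcomp Require Import all_boot all_order all_fingroup all_algebra.
From mathcomp Require Import all_solvable mxrepresentation spectral.
From mathcomp Require Import reals complex.

Set Implicit Arguments.
Unset Strict Implicit.
Unset Printing Implicit Defensive.

Import GroupScope Order.TTheory GRing.Theory Num.Theory.
Local Open Scope ring_scope.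

Section CayleyColorGraph.

Variables (C : numClosedFieldType) (gT : finGroupType).

Definition cayley_color (alpha : gT -> C) (g g' : gT) : C :=
  alpha (g' * g^-1)%g.

(* Rows and columns are indexed by G through [enum_val : 'I_#|G| -> gT]. *)
Definition cayley_adj (G : {group gT}) (alpha : gT -> C) : 'M[C]_#|G| :=
  \matrix_(x, y) cayley_color alpha (enum_val x) (enum_val y).

Record complete_unitary_irreps (G : {group gT}) (n : nat) (d : 'I_n -> nat)
    (rho : forall u, mx_representation C G (d u)) : Prop :=
  CompleteUnitaryIrreps {
    cui_unitary : forall u x, x \in G -> rho u x \is unitarymx;
    cui_irr : forall u, mx_irreducible (rho u);
    cui_inequiv : forall u v, mx_rsim (rho u) (rho v) -> u = v;
    cui_complete : forall m (sigma : mx_representation C G m),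
      (forall x, x \in G -> sigma x \is unitarymx) ->
      mx_irreducible sigma -> exists u, mx_rsim sigma (rho u)
  }.

Definition repr_char (G : {group gT}) (n : nat)
    (rho : mx_representation C G n) (x : gT) : C := \tr (rho x).

Section SemidirectEigen.

Variables (H K : {group gT}) (r s : nat).
Variables (dH : 'I_r -> nat) (dK : 'I_s -> nat).
Variable rhoH : forall u, mx_representation C H (dH u).
Variable rhoK : forall v, mx_representation C K (dK v).

Definition lambda (cl : 'I_r -> {set gT}) (hc : 'I_r -> gT) (alpha : gT -> C)
    (u : 'I_r) (v : 'I_s) : C :=
  ((dH u)%:R * (dK v)%:R)^-1 *
  \sum_(i < r) (#|cl i|%:R * repr_char (rhoH u) (hc i) *
     \sum_(k in K) alpha (hc i * k)%g * repr_char (rhoK v) k).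

(* When H and K meet trivially, [divgr H K] and [remgr H K] send h * k to h
   and k respectively; see [wvecE]. *)
Definition wvec (G : {group gT}) (u : 'I_r) (v : 'I_s)
    (i j : 'I_(dH u)) (i' j' : 'I_(dK v)) : 'cV[C]_#|G| :=
  \col_x (sqrtC (((dH u)%:R * (dK v)%:R) / (#|H|%:R * #|K|%:R)) *
          rhoH u (divgr H K (enum_val x)) i j *
          rhoK v (remgr H K (enum_val x)) i' j').

Lemma wvecE (G : {group gT}) u v i j i' j' (h k : gT) (x : 'I_#|G|) :
  K ><| H = G -> h \in H -> k \in K -> enum_val x = (h * k)%g ->
  @wvec G u v i j i' j' x 0 =
    sqrtC (((dH u)%:R * (dK v)%:R) / (#|H|%:R * #|K|%:R)) *
    rhoH u h i j * rhoK v k i' j'.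
Proof.
move=> /sdprodP[_ _ _ tiKH] Hh Kk xE; rewrite mxE xE.
by rewrite divgrMid ?remgrMid // setIC.
Qed.

Definition windex : finType :=
  {uv : 'I_r * 'I_s &
     'I_(dH uv.1) * 'I_(dH uv.1) * ('I_(dK uv.2) * 'I_(dK uv.2))}%type.

Definition wvec_at (G : {group gT}) (t : windex) : 'cV[C]_#|G| :=
  wvec G (tagged t).1.1 (tagged t).1.2 (tagged t).2.1 (tagged t).2.2.

End SemidirectEigen.

End CayleyColorGraph.

(* Main.v *)
Require Import Defs.
From HB Require Import structures.
From mathcomp Require Import all_boot all_order all_fingroup all_algebra.
From mathcomp Require Import all_solvable mxrepresentation spectral.
From mathcomp Require Import reals complex classfun ring.

Set Implicit Arguments.
Unset Strict Implicit.
Unset Printing Implicit Defensive.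

Import GroupScope Order.TTheory GRing.Theory Num.Theory.
Local Open Scope ring_scope.

(** Writing [g = h * k] and [x = h1 * k1], the invariance of [alpha] lets one
  replace [k1] by its conjugate under [h], so that the [g]-entry of [A *m w]
  factors as a product of the operators [\sum_k alpha (h1 * k) *: rhoK k] and
  [\sum_h1 beta h1 *: rhoH h1], both of which commute with an irreducible
  representation and hence are scalar by Schur's lemma; the product of the two
  scalars is [lambda u v].  The vectors [w] are independent by Schur
  orthogonality, and there are [#|H| * #|K| = #|G|] of them because the sum of
  the squared degrees of the irreducible representations is the group order.
  As completeness is only assumed among unitary representations, the latter
  requires that every representation is similar to a unitary one. *)

(** * Matrices with a basis of eigenvectors indexed by a finite type *)

Section EigenFamily.

Variables (F : fieldType) (n : nat) (T : finType) (w : T -> 'cV[F]_n).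

(** Pairing a vanishing combination of the [w t] with [w' t] leaves only the coefficient at [t],
    scaled by the nonzero [c t]. *)
Lemma free_dual_family (w' : T -> 'rV[F]_n) (c : T -> F) :
    (forall t, c t != 0) ->
    (forall t t', w' t *m w t' = (c t *+ (t == t'))%:M) ->
  free [seq w t | t : T].
Proof.
move=> c_neq0 dual; pose X := [tuple of [seq w t | t <- enum_tuple T]].
have ->: [seq w t | t : T] = X by [].
apply/freeP=> k kX0 i; pose t := tnth (enum_tuple T) i.
have /(congr1 (mulmx (w' t))) := kX0; rewrite mulmx0 mulmx_sumr.
rewrite (bigD1 i) //= big1 ?addr0 => [|j ji].
  rewrite -scalemxAr -tnth_nth tnth_map dual eqxx => /matrixP/(_ 0 0).
  rewrite !mxE eqxx mulr1n => /eqP.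
  by rewrite mulf_eq0 (negPf (c_neq0 _)) orbF => /eqP.
rewrite -scalemxAr -tnth_nth tnth_map dual; case: eqP => [eq_t|_]; last first.
  by rewrite raddf0 scaler0.
have/tuple_uniqP enum_inj : uniq (enum_tuple T) by exact: enum_uniq.
by rewrite (enum_inj _ _ eq_t) eqxx in ji.
Qed.

Variables (A : 'M[F]_n) (lam : T -> F).
Hypothesis w_basis : basis_of fullv [seq w t | t : T].
Hypothesis w_eigen : forall t, A *m w t = lam t *: w t.

Lemma card_basis_family : #|T| = n.
Proof.
pose X := [tuple of [seq w t | t <- enum_tuple T]].
have := @size_basis _ _ fullv #|T| X w_basis.
by rewrite dimvf /dim /= muln1.
Qed.

Lemma basis_family_sum (v : 'cV[F]_n) : exists k, v = \sum_t k t *: w t.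
Proof.
pose X := [tuple of [seq w t | t <- enum_tuple T]].
exists (fun t => coord X (enum_rank t) v).
rewrite {1}(coord_basis (X := X) w_basis (memvf v)).
rewrite (reindex (@enum_rank T)); last exact/onW_bij/enum_rank_bij.
apply: eq_bigr => t _; congr (_ *: _).
by rewrite (nth_map t) -?cardE // nth_enum_rank.
Qed.

Lemma basis_family_eq0 (k : T -> F) :
  \sum_t k t *: w t = 0 -> forall t, k t = 0.
Proof.
pose X := [tuple of [seq w t | t <- enum_tuple T]] => k0 t.
have /freeP Xfree : free X by exact: basis_free w_basis.
rewrite -[t]enum_rankK; apply: (Xfree (k \o enum_val)); rewrite -[RHS]k0.
rewrite [RHS](reindex (@enum_val T predT)); last exact/onW_bij/enum_val_bij.
apply: eq_bigr => i _; congr (_ *: _).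
by rewrite (nth_map (enum_val i)) -?cardE // -enum_val_nth.
Qed.

(** With the [w t] as columns of [P], the eigenvector equations read [A *m P = P *m D] for a
    diagonal [D], so [A] and [D] share their characteristic polynomial. *)
Lemma char_poly_eigenbasis : char_poly A = \prod_t ('X - (lam t)%:P).
Proof.
pose f t := cast_ord card_basis_family (enum_rank t).
pose g i := enum_val (cast_ord (esym card_basis_family) i).
have fK : cancel f g by move=> t; rewrite /g cast_ordK enum_rankK.
have gK : cancel g f by move=> i; rewrite /f enum_valK cast_ordKV.
have f_bij : bijective f by exists g.
pose P := \matrix_(x, y < n) w (g y) x 0.
pose D := diag_mx (\row_(y < n) lam (g y)).
have mulP v : P *m v = \sum_t v (f t) 0 *: w t.
  apply/colP=> x; rewrite mxE summxE (reindex f) /=; last exact/onW_bij.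
  by apply: eq_bigr => t _; rewrite !mxE fK mulrC.
(* A row [u] in the kernel of [P^T] gives [P *m u^T = 0], a vanishing combination of the basis. *)
have detP : \det P != 0.
  rewrite -det_tr -unitfE -[_ \is a _]/(_ \in unitmx) -row_free_unit -kermx_eq0.
  apply/eqP/row_matrixP=> i; rewrite row0; set u := row i _.
  have /(congr1 trmx): u *m P^T = 0 by apply/sub_kermxP; exact: row_sub.
  rewrite trmx_mul trmxK mulP trmx0 => /basis_family_eq0 u0.
  by apply/rowP=> j; have:= u0 (g j); rewrite mxE gK => ->; rewrite mxE.
have AP : A *m P = P *m D.
  apply/matrixP=> x y; rewrite mul_mx_diag !mxE.
  have /colP/(_ x) := w_eigen (g y); rewrite !mxE mulrC => <-.
  by apply: eq_bigr => z _; rewrite !mxE.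
have <-: char_poly D = \prod_t ('X - (lam t)%:P).
  rewrite char_poly_trig ?diag_mx_is_trig // (reindex f); last exact/onW_bij.
  by apply: eq_bigr => t _; rewrite !mxE eqxx fK.
(* Instead of inverting [P], both sides are multiplied by its determinant, a nonzero constant
   polynomial. *)
have detPX : \det (map_mx polyC P) != 0 by rewrite det_map_mx polyC_eq0.
apply: (mulIf detPX); rewrite [RHS]mulrC -!det_mulmx; congr (\det _).
rewrite /char_poly_mx mulmxBl mulmxBr -!map_mxM AP; congr (_ - _).
by rewrite scalar_mxC.
Qed.

(** For [v = \sum_t k t *: w t], the equation [A *m v = a *: v] forces every [k t * (lam t - a)] to
    vanish by independence, so only terms with [lam t = a] survive. *)
Lemma leigenspace_eigenbasis a :
  passmx.leigenspace (linfun (mulmx A)) a =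
  <<[seq w t | t <- enum T & lam t == a]>>%VS.
Proof.
apply/vspaceP=> v; rewrite memv_ker !lfunE /= !lfunE /= scale_lfunE id_lfunE.
rewrite subr_eq0.
apply/eqP/idP=> [|].
  have [k ->] := basis_family_sum v; rewrite mulmx_sumr scaler_sumr => /eqP.
  rewrite -subr_eq0 -sumrB => /eqP vE; apply: memv_suml => t _.
  have: k t * (lam t - a) = 0.
    apply: (@basis_family_eq0 (fun t => k t * (lam t - a))); rewrite -[RHS]vE.
    apply: eq_bigr => {}t _.
    by rewrite -scalemxAr w_eigen !scalerA mulrBr scalerBl [k t * a]mulrC.
  move/eqP; rewrite mulf_eq0 subr_eq0 => /orP[/eqP->|lamt].
    by rewrite scale0r mem0v.
  by rewrite memvZ // memv_span // map_f // mem_filter lamt mem_enum.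
set S := span _; suff /subvP: (S <= passmx.leigenspace (linfun (mulmx A)) a)%VS.
  move=> h /h; rewrite memv_ker !lfunE /= !lfunE /= scale_lfunE id_lfunE.
  by rewrite subr_eq0 => /eqP.
apply/span_subvP=> x /mapP[t]; rewrite mem_filter => /andP[/eqP<- _] ->.
by rewrite memv_ker !lfunE /= !lfunE /= scale_lfunE id_lfunE subr_eq0 w_eigen.
Qed.

End EigenFamily.

(** * Schur's lemma and the orthogonality of matrix entries *)

Section Schur.

Variables (C : numClosedFieldType) (gT : finGroupType) (G : {group gT}).

Lemma mx_irr_degree_gt0 n (rG : mx_representation C G n) :
  mx_irreducible rG -> (0 < n)%N.
Proof. by case/mx_irrP. Qed.

(** Schur's lemma over an algebraically closed field; the trace identifies the scalar, since [n] is
    positive. *)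
Lemma mx_irr_cent_scalar n (rG : mx_representation C G n) (B : 'M_n) :
    mx_irreducible rG -> (forall x, x \in G -> B *m rG x = rG x *m B) ->
  B = (n%:R^-1 * \tr B)%:M.
Proof.
move=> irrG cGB; have absG := @group_closure_closed_field C gT G n rG irrG.
have /is_scalar_mxP[a ->] := mx_abs_irr_cent_scalar absG (introT centgmxP cGB).
have n_gt0 := mx_irr_degree_gt0 irrG.
by rewrite mxtrace_scalar -[a *+ n]mulr_natl mulKf // pnatr_eq0 -lt0n.
Qed.

(** The row space of [B] is a submodule for [rG2] and its left kernel one for [rG1], so a nonzero
    [B] would be an isomorphism. *)
Lemma mx_irr_intertwine0 n1 n2 (rG1 : mx_representation C G n1)
    (rG2 : mx_representation C G n2) (B : 'M_(n1, n2)) :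
    mx_irreducible rG1 -> mx_irreducible rG2 ->
    (forall x, x \in G -> rG1 x *m B = B *m rG2 x) ->
  ~ mx_rsim rG1 rG2 -> B = 0.
Proof.
move=> /mx_irrP[_ irr1] /mx_irrP[_ irr2] homB nsim.
apply/eqP; apply/idPn => nzB; case: nsim.
have fullB : row_full B.
  rewrite /row_full -(genmxE B); apply: irr2; last first.
    by rewrite -mxrank_eq0 genmxE mxrank_eq0.
  rewrite (eqmx_module _ (genmxE B)); apply/mxmoduleP => x Gx.
  by rewrite -homB // submxMl.
have freeB : row_free B.
  rewrite -kermx_eq0; apply: contraT => nzK.
  have /irr1/(_ nzK): mxmodule rG1 (kermx B).
    apply/mxmoduleP=> x Gx; apply/sub_kermxP.
    by rewrite -mulmxA homB // mulmxA mulmx_ker mul0mx.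
  rewrite -sub1mx => /sub_kermxP; rewrite mul1mx => B0.
  by rewrite B0 eqxx in nzB.
by exists B => //; rewrite -(eqP freeB) (eqP fullB).
Qed.

(** Reindexing by conjugation shows that the sum commutes with [rG], so it is a scalar determined by
    its trace. *)
Lemma mx_irr_class_sum n (rG : mx_representation C G n) (phi : gT -> C) :
    mx_irreducible rG ->
    {in G &, forall x y, phi (x * y * x^-1)%g = phi y} ->
  \sum_(x in G) phi x *: rG x =
    (n%:R^-1 * \sum_(x in G) phi x * \tr (rG x))%:M.
Proof.
move=> irrG phiJ; rewrite [LHS](mx_irr_cent_scalar irrG) => [|x Gx].
  congr (_ * _)%:M; rewrite raddf_sum; apply: eq_bigr => x _.
  by rewrite /= mxtraceZ.
rewrite mulmx_suml mulmx_sumr [RHS](reindex_inj (conjg_inj x)) /=.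
apply: eq_big => [y|y Gy]; first by rewrite groupJr.
rewrite -scalemxAl -scalemxAr -!repr_mxM ?groupJ //.
by rewrite -conjgC -[in RHS](phiJ x) ?groupJ // conjgE !mulgA mulgV mul1g mulgK.
Qed.

Section Average.

Variables (n1 n2 : nat) (rG1 : mx_representation C G n1).
Variables (rG2 : mx_representation C G n2) (B : 'M[C]_(n1, n2)).

(** Averaging turns any [B] into an intertwiner; taking [B] to be a matrix unit makes its entries
    the sums of the Schur relations. *)
Definition mx_average : 'M[C]_(n1, n2) :=
  \sum_(x in G) rG1 x *m B *m rG2 (x^-1)%g.

Lemma mx_average_hom y : y \in G -> rG1 y *m mx_average = mx_average *m rG2 y.
Proof.
move=> Gy; rewrite mulmx_suml mulmx_sumr.
rewrite [RHS](reindex_inj (mulgI y)) /=.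
apply: eq_big => [x|x Gx]; first by rewrite groupMl.
rewrite !repr_mxM ?invMg ?groupMl ?groupV // repr_mxM ?groupV //.
by rewrite !mulmxA repr_mxKV.
Qed.

End Average.

Lemma mx_average_delta n1 n2 (rG1 : mx_representation C G n1)
    (rG2 : mx_representation C G n2) i j k l :
  mx_average rG1 rG2 (delta_mx j k) i l =
    \sum_(x in G) rG1 x i j * rG2 (x^-1)%g k l.
Proof.
rewrite summxE; apply: eq_bigr => x _.
rewrite !mxE (bigD1 k) //= big1 ?addr0 => [|m mk].
  rewrite !mxE (bigD1 j) //= big1 ?addr0 ?mxE ?eqxx ?mulr1 // => m mj.
  by rewrite !mxE (negPf mj) mulr0.
rewrite !mxE big1 ?mul0r // => p _.
by rewrite !mxE (negPf mk) andbF mulr0.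
Qed.

Lemma mx_irr_orthogonal n1 n2 (rG1 : mx_representation C G n1)
    (rG2 : mx_representation C G n2) i j k l :
    mx_irreducible rG1 -> mx_irreducible rG2 -> ~ mx_rsim rG1 rG2 ->
  \sum_(x in G) rG1 x i j * rG2 (x^-1)%g k l = 0.
Proof.
move=> irr1 irr2 nsim; rewrite -mx_average_delta.
rewrite [mx_average _ _ _](mx_irr_intertwine0 irr1 irr2 _ nsim) ?mxE //.
by move=> x /mx_average_hom.
Qed.

Lemma mx_irr_orthonormal n (rG : mx_representation C G n) i j k l :
    mx_irreducible rG ->
  \sum_(x in G) rG x i j * rG (x^-1)%g k l =
    (#|G|%:R / n%:R) *+ ((i == l) && (j == k)).
Proof.
move=> irrG; rewrite -mx_average_delta.
rewrite [mx_average _ _ _](mx_irr_cent_scalar irrG).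
  rewrite mxE /mx_average raddf_sum /=.
  (* By cyclicity of the trace [rG x] and its inverse cancel, leaving the trace of
     [delta_mx j k]. *)
  rewrite (eq_bigr (fun=> (j == k)%:R)) => [|x Gx].
    rewrite sumr_const; case: (i == l); case: (j == k) => //=.
      by rewrite mulr1n mulrC.
    by rewrite mul0rn mulr0.
  rewrite mxtrace_mulC mulmxA -repr_mxM ?groupV // mulVg repr_mx1 mul1mx.
  rewrite /mxtrace (bigD1 j) //= big1 ?addr0 ?mxE ?eqxx // => m mj.
  by rewrite mxE (negPf mj).
by move=> x /mx_average_hom.
Qed.

End Schur.

(** * Unitarity through an invariant Hermitian form *)

Section Unitarization.

Variables (C : numClosedFieldType) (gT : finGroupType) (G : {group gT}).
Local Open Scope sesquilinear_scope.

Lemma mx_rsim_unitary n (rG : mx_representation C G n) :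
  exists2 rG' : mx_representation C G n,
    mx_rsim rG rG' & forall x, x \in G -> rG' x \is unitarymx.
Proof.
(* If [B *m P *m B^t* = 1] for the invariant positive form [P], then
   conjugating [rG] by [B] makes it unitary. *)
pose P := \sum_(x in G) rG x *m (rG x)^t*.
have trC (m p q : nat) (X : 'M[C]_(m, p)) (Y : 'M_(p, q)) :
  (X *m Y)^t* = Y^t* *m X^t* by rewrite trmx_mul map_mxM.
have PJ y : y \in G -> rG y *m P *m (rG y)^t* = P.
  move=> Gy; rewrite mulmx_sumr mulmx_suml [RHS](reindex_inj (mulgI y)) /=.
  apply: eq_big => [x|x Gx]; first by rewrite groupMl.
  by rewrite repr_mxM // trC !mulmxA.
have Pherm : P^t* = P.
  rewrite !raddf_sum; apply: eq_bigr => x _ /=.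
  by rewrite trC trmxCK.
have Pnormal : P \is normalmx by apply/normalmxP; rewrite Pherm.
have /orthomx_spectralP := Pnormal; have := spectral_unitarymx P.
move: (spectralmx P) (spectral_diag P) => U d Uu PE.
rewrite invmx_unitary // in PE.
have UU : U *m U^t* = 1%:M by exact/unitarymxP.
(* Each eigenvalue of [P] is a sum of squared norms, to which the summand at [x = 1] contributes
   exactly 1. *)
have d_gt0 i : 0 < d 0 i.
  have ->: d 0 i = (U *m P *m U^t*) i i.
    by rewrite PE !mulmxA UU mul1mx -mulmxA UU mulmx1 !mxE eqxx.
  have dotE x : (U *m (rG x *m (rG x)^t*) *m U^t*) i i =
      \sum_j `|(U *m rG x) i j| ^+ 2.
    rewrite mulmxA -[_ *m _ *m U^t*]mulmxA -trC mxE.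
    by apply: eq_bigr => j _; rewrite normCK !mxE.
  rewrite mulmx_sumr mulmx_suml summxE (bigD1 1%g) //= ltr_wpDr //.
    apply: sumr_ge0 => x _; rewrite dotE.
    by apply: sumr_ge0 => j _; rewrite exprn_ge0.
  by rewrite repr_mx1 trmx1 map_mx1 mulmx1 mulmx1 UU mxE eqxx.
(* Rescaling the rows of [U] by the inverse square roots of the eigenvalues turns the diagonalized
   [P] into the identity. *)
pose e := \row_i (sqrtC (d 0 i))^-1.
have [B BPB] : exists B : 'M_n, B *m P *m B^t* = 1%:M.
  exists (diag_mx e *m U).
  have eC : map_mx Num.conj e = e.
    apply/rowP=> i; rewrite !mxE; apply: CrealP.
    by rewrite realV ger0_real // sqrtC_ge0 ltW.
  rewrite trC tr_diag_mx map_diag_mx eC PE !mulmxA.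
  rewrite mulmxtVK // mulmxtVK // !mulmx_diag -diag_const_mx; congr diag_mx.
  apply/rowP=> i; rewrite !mxE mulrAC -invfM -expr2 sqrtCK mulVf //.
  exact: lt0r_neq0.
have unitB : B \in unitmx.
  by move: BPB; rewrite -mulmxA => /mulmx1_unit[].
have PV : invmx B *m (invmx B)^t* = P.
  rewrite -[X in X *m _]mulmx1 -BPB !mulmxA mulVmx // mul1mx -mulmxA -trC.
  by rewrite mulVmx // trmx1 map_mx1 mulmx1.
exists (rconj_repr rG unitB) => [|x Gx].
  exists (invmx B) => //; first by rewrite row_free_unit unitmx_inv.
  by move=> x Gx; rewrite /= /rconj_mx !mulmxA mulVmx // mul1mx.
apply/unitarymxP; rewrite /= /rconj_mx !trC !mulmxA.
rewrite -[_ *m (invmx B)^t*]mulmxA PV.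
by rewrite -[B *m _ *m P]mulmxA -[B *m _ *m _]mulmxA PJ.
Qed.

End Unitarization.

(** * The sum of the squared degrees *)

Section Completeness.

Variables (C : numClosedFieldType) (gT : finGroupType) (G : {group gT}).
Variables (r : nat) (d : 'I_r -> nat).
Variable rho : forall u, mx_representation C G (d u).
Hypothesis rho_complete : complete_unitary_irreps rho.

(** The family [rho] is matched bijectively with the irreducible components of the regular
    representation, for which the degree formula is known. *)
Lemma complete_unitary_irreps_degree : (\sum_u d u ^ 2 = #|G|)%N.
Proof.
have [_ irr_rho rho_inj rho_surj] := rho_complete.
pose sG := DecSocleType (regular_repr C G).
have C'G : [pchar C]^'.-group G 
  by rewrite /pgroup pcharf'_nat pnatr_eq0 -lt0n.
have splitG := @group_closure_closed_field C gT G.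
rewrite -(sum_irr_degree_pchar sG C'G splitG).
pose f u := irr_comp sG (rho u).
have simf u : mx_rsim (rho u) (irr_repr (f u)) by exact: rsim_irr_comp_pchar.
have f_inj : injective f.
  move=> u v fuv; apply: rho_inj; apply: mx_rsim_trans (simf u) _.
  by rewrite fuv; exact/mx_rsim_sym/simf.
(* The component [irr_repr i] need not be unitary, so it is replaced by a similar unitary one before
   completeness applies. *)
have f_surj i : exists u, i == f u.
  have [rG' sim' unit'] := mx_rsim_unitary (irr_repr i).
  have [u simu] := rho_surj _ rG' unit' (mx_rsim_irr sim' (socle_irr i)).
  exists u; apply/socle_rsimP; apply: mx_rsim_trans sim' _.
  exact: mx_rsim_trans simu (simf u).
rewrite [RHS](reindex f) /=.
  by apply: eq_bigr => u _; rewrite (mxrank_rsim (simf u)).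
exists (fun i => xchoose (f_surj i)) => [u _|i _]; last first.
  exact/esym/eqP/(xchooseP (f_surj i)).
by apply: f_inj; apply/esym/eqP/(xchooseP (f_surj (f u))).
Qed.

End Completeness.

(** * The eigenbasis of a semidirect product *)

Section SemidirectEigenbasis.

Variables (C : numClosedFieldType) (gT : finGroupType) (G H K : {group gT}).
Hypothesis defG : K ><| H = G.

Lemma sum_sdprod (V : nmodType) (F : gT -> V) :
  \sum_(g in G) F g = \sum_(h in H) \sum_(k in K) F (h * k)%g.
Proof.
have [_ defKH nKH tiKH] := sdprodP defG.
have tiHK : H :&: K = 1%g by rewrite setIC.
have defHK : (H * K)%g = G by rewrite (normC nKH).
rewrite pair_big /= (reindex_onto (fun p : gT * gT => (p.1 * p.2)%g)
  (fun g => (divgr H K g, remgr H K g))) /= => [|g _]; last first.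
  by rewrite -divgr_eq.
apply: eq_bigl => -[h k] /=; rewrite xpair_eqE.
apply/idP/andP=> [/and3P[Ghk /eqP hE /eqP kE]|[Hh Kk]].
  by split; [rewrite -hE mem_divgr | rewrite -kE mem_remgr]; rewrite ?defHK.
by rewrite -defHK mem_mulg // divgrMid // remgrMid // !eqxx.
Qed.

Lemma sum_classes (r : nat) (cl : 'I_r -> {set gT}) (hc : 'I_r -> gT)
    (phi : gT -> C) :
    injective cl -> [set cl i | i : 'I_r] = classes H ->
    (forall i, hc i \in cl i) ->
    {in H &, forall x y, phi (x * y * x^-1)%g = phi y} ->
  \sum_(h in H) phi h = \sum_i #|cl i|%:R * phi (hc i).
Proof.
move=> cl_inj cl_classes hc_cl phiJ.
have phiJ' : {in H &, forall x y, phi (x ^ y)%g = phi x}.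
  by move=> x y Hx Hy; rewrite conjgE mulgA -{2}[y]invgK phiJ ?groupV.
rewrite sum_by_classes // -cl_classes big_imset /=; last first.
  by move=> i j _ _; exact: cl_inj.
apply: eq_bigr => i _; congr (_ * _).
have /imsetP[x Hx cliE] : cl i \in classes H by rewrite -cl_classes imset_f.
(* [sum_by_classes] evaluates at [repr]; that point and [hc i] are both conjugates of [x]. *)
have: hc i \in (x ^: H)%g by rewrite -cliE.
have: repr (x ^: H)%g \in (x ^: H)%g by exact: mem_repr (class_refl _ _).
by rewrite cliE => /imsetP[y Hy ->] /imsetP[z Hz ->]; rewrite !phiJ'.
Qed.

Variables (r s : nat) (dH : 'I_r -> nat) (dK : 'I_s -> nat).
Variable rhoH : forall u, mx_representation C H (dH u).
Variable rhoK : forall v, mx_representation C K (dK v).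
Hypothesis rhoH_complete : complete_unitary_irreps rhoH.
Hypothesis rhoK_complete : complete_unitary_irreps rhoK.

Let irrH u : mx_irreducible (rhoH u). Proof. exact: cui_irr. Qed.
Let irrK v : mx_irreducible (rhoK v). Proof. exact: cui_irr. Qed.

(** The operation is left abstract because addition serves to count the indices and multiplication
    to collect equal factors of the characteristic polynomial. *)
Lemma big_windex (V : Type) (idx : V) (op : Monoid.com_law idx)
    (f : 'I_r -> 'I_s -> V) :
  \big[op/idx]_(t : windex dH dK) f (tag t).1 (tag t).2 =
  \big[op/idx]_u \big[op/idx]_v iterop ((dH u * dK v) ^ 2) op (f u v) idx.
Proof.
transitivity (\big[op/idx]_(uv : 'I_r * 'I_s) \big[op/idx]_(j :
    'I_(dH uv.1) * 'I_(dH uv.1) * ('I_(dK uv.2) * 'I_(dK uv.2))) f uv.1 uv.2).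
  by rewrite sig_big_dep; apply: eq_bigl => -[].
rewrite pair_bigA; apply: eq_bigr => -[u v] _ /=.
by rewrite big_const !card_prod !card_ord !mulnn expnMn Monoid.iteropE.
Qed.

Lemma card_windex : #|windex dH dK| = #|G|.
Proof.
rewrite -[LHS]sum1_card [LHS](big_windex _ (fun _ _ => 1%N)).
rewrite -(sdprod_card defG) mulnC.
rewrite -(complete_unitary_irreps_degree rhoH_complete).
rewrite -(complete_unitary_irreps_degree rhoK_complete) big_distrl /=.
apply: eq_bigr => u _; rewrite big_distrr; apply: eq_bigr => v _ /=.
by rewrite Monoid.iteropE iter_addn_0 mul1n expnMn.
Qed.

Definition wnorm (u : 'I_r) (v : 'I_s) : C :=
  sqrtC (((dH u)%:R * (dK v)%:R) / (#|H|%:R * #|K|%:R)).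

Lemma wnorm_neq0 u v : wnorm u v != 0.
Proof.
have dHu := mx_irr_degree_gt0 (irrH u); have dKv := mx_irr_degree_gt0 (irrK v).
rewrite sqrtC_eq0 !mulf_eq0 invr_eq0 mulf_eq0 !pnatr_eq0 !negb_or -!lt0n.
by rewrite dHu dKv !cardG_gt0.
Qed.

(* By Schur orthogonality these are, up to scalars, dual to the [wvec_at]. *)
Definition wdual (t : windex dH dK) : 'rV[C]_#|G| :=
  \row_x (rhoH (tag t).1 (divgr H K (enum_val x))^-1%g
            (tagged t).1.2 (tagged t).1.1 *
          rhoK (tag t).2 (remgr H K (enum_val x))^-1%g
            (tagged t).2.2 (tagged t).2.1).

(** Unique factorization [g = h * k] splits the pairing into a Schur sum over [H] times one over
    [K]. *)
Lemma wdual_wvec t t' :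
  wdual t *m wvec_at rhoH rhoK G t' =
    (wnorm (tag t).1 (tag t).2 * (#|H|%:R / (dH (tag t).1)%:R) *
       (#|K|%:R / (dK (tag t).2)%:R) *+ (t == t'))%:M.
Proof.
have [_ _ _ tiKH] := sdprodP defG; have tiHK : H :&: K = 1%g by rewrite setIC.
have ->: wdual t *m wvec_at rhoH rhoK G t' =
  (wnorm (tag t').1 (tag t').2 *
  (\sum_(h in H) rhoH (tag t').1 h (tagged t').1.1 (tagged t').1.2 *
     rhoH (tag t).1 h^-1%g (tagged t).1.2 (tagged t).1.1) *
  (\sum_(k in K) rhoK (tag t').2 k (tagged t').2.1 (tagged t').2.2 *
     rhoK (tag t).2 k^-1%g (tagged t).2.2 (tagged t).2.1))%:M.
  apply/matrixP=> a b; rewrite !ord1 !mxE eqxx mulr1n.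
  transitivity (\sum_(g in G)
    (rhoH (tag t).1 (divgr H K g)^-1%g (tagged t).1.2 (tagged t).1.1 *
    rhoK (tag t).2 (remgr H K g)^-1%g (tagged t).2.2 (tagged t).2.1) *
    (wnorm (tag t').1 (tag t').2 *
     rhoH (tag t').1 (divgr H K g) (tagged t').1.1 (tagged t').1.2 *
     rhoK (tag t').2 (remgr H K g) (tagged t').2.1 (tagged t').2.2)).
    by rewrite [RHS]big_enum_val; apply: eq_bigr => x _; rewrite !mxE.
  rewrite sum_sdprod -mulrA big_distrl /= mulr_sumr; apply: eq_bigr => h Hh.
  rewrite big_distrr /= mulr_sumr; apply: eq_bigr => k Kk.
  rewrite divgrMid // remgrMid //; ring.
congr (_%:M).
case: t t' => [[u v] [[i j] [k l]]] [[u' v'] [[i' j'] [k' l']]] /=.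
have [uu'|uu'] := eqVneq u' u; last first.
  rewrite (mx_irr_orthogonal _ _ _ _ (irrH _) (irrH _)); last first.
    by move/(cui_inequiv rhoH_complete)/eqP; rewrite (negPf uu').
  rewrite mulr0 mul0r; case: eqP => // E; case/eqP: uu'.
  by have /(congr1 (fun t => (tag t).1)) := E.
have [vv'|vv'] := eqVneq v' v; last first.
  rewrite [X in _ * X](mx_irr_orthogonal _ _ _ _ (irrK _) (irrK _)); last first.
    by move/(cui_inequiv rhoK_complete)/eqP; rewrite (negPf vv').
  rewrite mulr0; case: eqP => // E; case/eqP: vv'.
  by have /(congr1 (fun t => (tag t).2)) := E.
(* The types of the matrix indices depend on [u'] and [v'], so the indices are generalized before
   these equalities are substituted. *)
move: i' j' k' l'; rewrite {}uu' {}vv' => i' j' k' l'.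
rewrite !mx_irr_orthonormal // eq_Tagged /= !xpair_eqE.
rewrite [i' == i]eq_sym [j' == j]eq_sym [k' == k]eq_sym [l' == l]eq_sym.
by case: (i == _); case: (j == _); case: (k == _); case: (l == _);
  rewrite /= ?mulr0 ?mul0r.
Qed.

Lemma wvec_at_basis :
  basis_of fullv [seq wvec_at rhoH rhoK G t | t : windex dH dK].
Proof.
have c_neq0 (t : windex dH dK) : wnorm (tag t).1 (tag t).2 *
    (#|H|%:R / (dH (tag t).1)%:R) * (#|K|%:R / (dK (tag t).2)%:R) != 0.
  have dHt := mx_irr_degree_gt0 (irrH (tag t).1).
  have dKt := mx_irr_degree_gt0 (irrK (tag t).2).
  rewrite !mulf_neq0 ?invr_eq0 ?wnorm_neq0 ?pnatr_eq0 -?lt0n //.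
rewrite basisEfree subvf (free_dual_family c_neq0 wdual_wvec) /=.
by rewrite dimvf /dim /= muln1 size_map -cardE card_windex.
Qed.

Variables (cl : 'I_r -> {set gT}) (hc : 'I_r -> gT) (alpha : gT -> C).
Hypothesis cl_inj : injective cl.
Hypothesis cl_classes : [set cl i | i : 'I_r] = classes H.
Hypothesis hc_cl : forall i, hc i \in cl i.
Hypothesis alpha_K : forall g h k, g \in G -> h \in H -> k \in K ->
  alpha (h * (g * k * g^-1))%g = alpha (h * k)%g.
Hypothesis alpha_H : forall h h' k, h \in H -> h' \in H -> k \in K ->
  alpha (h' * h * h'^-1 * k)%g = alpha (h * k)%g.

Lemma cayley_adj_wvec u v (i j : 'I_(dH u)) (i' j' : 'I_(dK v)) :
  cayley_adj G alpha *m wvec rhoH rhoK G i j i' j' =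
    lambda rhoH rhoK cl hc alpha u v *: wvec rhoH rhoK G i j i' j'.
Proof.
have [nsKG sHG _ nKH _] := sdprod_context defG.
have [_ defKH _ tiKH] := sdprodP defG.
have tiHK : H :&: K = 1%g by rewrite setIC.
have sKG := normal_sub nsKG.
have defHK : (H * K)%g = G by rewrite (normC nKH).
(* The scalar to which Schur's lemma reduces the operator over [K] for fixed [h]; by [alpha_H] it is
   a class function on [H]. *)
pose beta h := (dK v)%:R^-1 * \sum_(k in K) alpha (h * k)%g * \tr (rhoK v k).
have betaJ : {in H &, forall x y, beta (x * y * x^-1)%g = beta y}.
  move=> x y Hx Hy; congr (_ * _); apply: eq_bigr => k Kk.
  by rewrite alpha_H.
have sumK h : h \in H ->
    \sum_(k in K) alpha (h * k)%g *: rhoK v k = (beta h)%:M.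
  move=> Hh.
  rewrite (@mx_irr_class_sum _ _ _ _ _ (fun k => alpha (h * k)%g)) //.
  by move=> x y Kx Ky; rewrite alpha_K // (subsetP sKG).
(* The trace in the Schur scalar is a sum of a class function, hence a sum over classes; the two
   inverse degrees combine into that of [lambda]. *)
have sumH : \sum_(h in H) beta h *: rhoH u h =
    (lambda rhoH rhoK cl hc alpha u v)%:M.
  rewrite mx_irr_class_sum //; congr (_%:M).
  rewrite (sum_classes (phi := fun h => beta h * \tr (rhoH u h))
    cl_inj cl_classes hc_cl) /=.
    rewrite /lambda invfM -mulrA; congr (_ * _); rewrite mulr_sumr.
    apply: eq_bigr => l _; rewrite /beta /repr_char; ring.
  move=> x y Hx Hy /=; rewrite betaJ //; congr (_ * _).
  rewrite !repr_mxM ?groupM ?groupV // mxtrace_mulC mulmxA.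
  by rewrite -repr_mxM ?groupV // mulVg repr_mx1 mul1mx.
apply/colP=> x; rewrite [RHS]mxE [in RHS]mxE mxE -/(wnorm u v).
set g := enum_val x; have Gg : g \in G by exact: enum_valP.
transitivity (\sum_(g' in G) cayley_color alpha g g' *
    (wnorm u v * rhoH u (divgr H K g') i j * rhoK v (remgr H K g') i' j')).
  by rewrite [RHS]big_enum_val; apply: eq_bigr => y _; rewrite !mxE.
have Hh : divgr H K g \in H by rewrite mem_divgr // defHK.
have Kk : remgr H K g \in K by rewrite mem_remgr // defHK.
have gE := divgr_eq H K g.
move: (divgr H K g) (remgr H K g) Hh Kk gE => h k Hh Kk gE.
(* Replacing [g'] by [g' * g] makes the color simply [alpha g']. *)
rewrite (reindex_inj (mulIg g)) /=.
under eq_bigl do rewrite groupMr //.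
rewrite sum_sdprod.
transitivity (\sum_(h1 in H) \sum_(k1 in K) alpha (h1 * k1)%g *
    (wnorm u v * rhoH u (h1 * h)%g i j * rhoK v (k1 * k)%g i' j')).
  (* Replacing [k1] by [h * k1 * h^-1] leaves [alpha] unchanged by [alpha_K], while the product with
     [g = h * k] becomes [(h1 * h) * (k1 * k)], separating the two factors. *)
  apply: eq_bigr => h1 Hh1; rewrite (reindex_inj (conjg_inj h^-1)%g) /=.
  have nKh : h^-1%g \in 'N(K)%g by rewrite groupV (subsetP nKH).
  apply: eq_big => [k1|k1 Kk1]; first by rewrite memJ_norm.
  rewrite memJ_norm // in Kk1.
  rewrite /cayley_color mulgK conjgE invgK [(h * _)%g]mulgA.
  rewrite alpha_K ?(subsetP sHG) //.
  have ->: (h1 * (h * k1 * h^-1) * g = (h1 * h) * (k1 * k))%g.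
    by rewrite gE !mulgA mulgKV.
  by rewrite divgrMid ?remgrMid ?groupM.
transitivity (wnorm u v * (\sum_(h1 in H) beta h1 *: rhoH u (h1 * h)%g) i j
   * rhoK v k i' j').
  rewrite summxE mulr_sumr mulr_suml; apply: eq_bigr => h1 Hh1.
  transitivity (wnorm u v * rhoH u (h1 * h)%g i j *
     ((\sum_(k1 in K) alpha (h1 * k1)%g *: rhoK v k1) *m rhoK v k) i' j').
    rewrite mulmx_suml summxE mulr_sumr; apply: eq_bigr => k1 Kk1.
    rewrite -scalemxAl -repr_mxM // [in RHS]mxE; ring.
  rewrite sumK // mul_scalar_mx !mxE; ring.
have ->: \sum_(h1 in H) beta h1 *: rhoH u (h1 * h)%g =
    (\sum_(h1 in H) beta h1 *: rhoH u h1) *m rhoH u h.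
  rewrite mulmx_suml; apply: eq_bigr => h1 Hh1.
  by rewrite -scalemxAl repr_mxM.
rewrite sumH mul_scalar_mx mxE; ring.
Qed.

End SemidirectEigenbasis.

Local Open Scope complex_scope.

Theorem theorem3p1 (R : realType) (gT : finGroupType) (G H K : {group gT})
  (defG : K ><| H = G)
  (r s : nat) (dH : 'I_r -> nat) (dK : 'I_s -> nat)
  (rhoH : forall u, mx_representation R[i] H (dH u))
  (rhoK : forall v, mx_representation R[i] K (dK v))
  (rhoH_complete : complete_unitary_irreps rhoH)
  (rhoK_complete : complete_unitary_irreps rhoK)
  (cl : 'I_r -> {set gT}) (hc : 'I_r -> gT)
  (cl_inj : injective cl)
  (cl_classes : [set cl i | i : 'I_r] = classes H)
  (hc_cl : forall i, hc i \in cl i)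
  (alpha : gT -> R[i])
  (alpha_K : forall g h k, g \in G -> h \in H -> k \in K ->
     alpha (h * (g * k * g^-1))%g = alpha (h * k)%g)
  (alpha_H : forall h h' k, h \in H -> h' \in H -> k \in K ->
     alpha (h' * h * h'^-1 * k)%g = alpha (h * k)%g) :
  let A := cayley_adj G alpha in
  let lam := lambda rhoH rhoK cl hc alpha in
  let w := wvec_at rhoH rhoK G in
  [/\ forall (u : 'I_r) (v : 'I_s) (i j : 'I_(dH u)) (i' j' : 'I_(dK v)),
        wvec rhoH rhoK G i j i' j' != 0 /\
        A *m wvec rhoH rhoK G i j i' j' =
          lam u v *: wvec rhoH rhoK G i j i' j',
      basis_of fullv [seq w t | t : windex dH dK],
      char_poly A =
        \prod_(u < r) \prod_(v < s)
          ('X - (lam u v)%:P) ^+ ((dH u * dK v) ^ 2)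
    & forall a : R[i],
        passmx.leigenspace (linfun (mulmx A)) a =
        <<[seq w t | t <- enum (windex dH dK) & lam (tag t).1 (tag t).2 == a]>>%VS].
Proof.
move=> A lam w; have w_basis := wvec_at_basis defG rhoH_complete rhoK_complete.
have w_eigen := cayley_adj_wvec defG rhoH_complete rhoK_complete cl_inj
  cl_classes hc_cl alpha_K alpha_H.
have wt_eigen t : A *m w t = lam (tag t).1 (tag t).2 *: w t by exact: w_eigen.
split=> // [u v i j i' j'||a].
- split; last exact: w_eigen.
  (* Packing the indices exhibits the vector as a member of the basis, hence nonzero. *)
  pose t : windex dH dK := Tagged (fun uv : 'I_r * 'I_s =>
    'I_(dH uv.1) * 'I_(dH uv.1) * ('I_(dK uv.2) * 'I_(dK uv.2)))%type
    (((i, j), (i', j')) : _ (u, v)).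
  by apply: (basis_not0 w_basis (x := w t)); apply: image_f.
- rewrite (char_poly_eigenbasis w_basis wt_eigen).
  exact: (big_windex _ _ _ (fun u v => 'X - (lam u v)%:P)).
- exact: leigenspace_eigenbasis w_basis wt_eigen a.
Qed.
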